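(* Two points $x,x'\in\mathbb R^2$ have the same orbit (i.e., $\operatorname{orb}(x)=\operatorname{orb}(x')$) if and only if $G_x=G_{x'}$ and $c_x=c_{x'}$.
   Context: Orbits: $\mathcal G_2=GL(2,\mathbb Z)\ltimes\mathbb Z^2$ is the group of affine transformations of $\mathbb R^2$ of the form $x\mapsto Ux+t$, with $t\in\mathbb Z^2$ and $U$ an integer $2\times2$ matrix with $\det(U)=\pm1$; $\operatorname{orb}(x)=\{\gamma(x)\mid\gamma\in\mathcal G_2\}$. For $x=(x_1,x_2)\in\mathbb R^2$, $G_x=\mathbb Z+\mathbb Zx_1+\mathbb Zx_2\subseteq\mathbb R$; equality $G_x=G_{x'}$ means equality as subsets of $\mathbb R$. Regular simplexes: a point $y\in\mathbb R^n$ is rational if all its coordinates are rational; its denominator $\operatorname{den}(y)$ is the least common denominator of its coordinates; its homogeneous correspondent is $\tilde y=\operatorname{den}(y)\,(y,1)\in\mathbb Z^{n+1}$. A simplex $\operatorname{conv}(v_0,\ldots,v_k)\subseteq\mathbb R^n$ with rational vertices is regular if $\{\tilde v_0,\ldots,\tilde v_k\}$ can be extended to a basis of the free abelian group $\mathbb Z^{n+1}$. The integer $c_x$: a rational hyperplane in $\mathbb R^n$ is a set $\{z\in\mathbb R^n\mid h\cdot z=k\}$ with $0\neq h\in\mathbb Q^n$, $k\in\mathbb Q$; a rational affine space is an intersection of rational hyperplanes ($\mathbb R^n$ itself being the empty intersection). For $x\in\mathbb R^n$, $F_x$ is the intersection of all rational hyperplanes of $\mathbb R^n$ containing $x$ (with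 $F_x=\mathbb R^n$ if there are none). For an $e$-dimensional rational affine space $F\subseteq\mathbb R^n$ ($0\le e\le n$), $c_F$ is the smallest possible denominator of a vertex of a regular $n$-simplex $\operatorname{conv}(v_0,\ldots,v_n)\subseteq\mathbb R^n$ with $v_0,\ldots,v_e\in F$ (the minimum is over all such simplexes and all of their vertices). Put $c_x=c_{F_x}$. Here $n=2$. *)

(* Defs.v *)
From HB Require Import structures.
From mathcomp Require Import all_boot all_order all_algebra.
From mathcomp Require Import all_classical all_reals.

Set Implicit Arguments.
Unset Strict Implicit.
Unset Printing Implicit Defensive.

Import Order.TTheory GRing.Theory Num.Theory.

Local Open Scope classical_set_scope.
Local Open Scope ring_scope.

(** * Orbits of the affine group over the integers *)

Definition affine_group (R : realType) (n : nat) : set ('cV[R]_n -> 'cV[R]_n) :=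
  [set g | exists (U : 'M[int]_n) (t : 'cV[int]_n),
     (\det U = 1 \/ \det U = -1) /\
     g = (fun x => map_mx intr U *m x + map_mx intr t)].

Definition orb (R : realType) (n : nat) (x : 'cV[R]_n) : set 'cV[R]_n :=
  [set g x | g in @affine_group R n].

(** [Ggrp x] is the subgroup Z + Z x_1 + ... + Z x_n of R. *)
Definition Ggrp (R : realType) (n : nat) (x : 'cV[R]_n) : set R :=
  [set r | exists (k : int) (h : 'I_n -> int),
     r = k%:~R + \sum_i (h i)%:~R * x i 0].

(** * Rational points and regular simplexes *)

(** A rational point of R^n is a vector of rationals, viewed in R^n through
    [ratpt]. *)
Definition ratpt (R : realType) (n : nat) (y : 'cV[rat]_n) : 'cV[R]_n :=
  map_mx ratr y.

Definition den (n : nat) (y : 'cV[rat]_n) : nat :=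
  \big[lcmn/1%N]_i `|denq (y i 0%R)|%N.

(** The vector den(y) (y, 1) has integral entries (see [homogE]), so [numq]
    reads off these entries as integers. *)
Definition homog (n : nat) (y : 'cV[rat]_n) : 'cV[int]_(n + 1) :=
  map_mx numq ((den y)%:R *: col_mx y (const_mx 1)).

Lemma homogE (n : nat) (y : 'cV[rat]_n) :
  map_mx intr (homog y) = (den y)%:R *: col_mx y (const_mx 1).
Proof.
have numqK (q : rat) : q \is a Num.int -> (numq q)%:~R = q.
  by move/intrP=> [z ->]; rewrite numq_int.
apply/matrixP => i j; rewrite !mxE; apply: numqK.
case: (fintype.split i) => k; rewrite ?mxE; last by rewrite mulr1 Num.Theory.natr_int.
have: (`|denq (y k j)| %| den y)%N.
  by rewrite (ord1 j) /den (bigD1 k) //= dvdn_lcml.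
case/dvdnP=> m ->; rewrite natrM -mulrA.
have -> : (`|denq (y k j)|)%:R * y k j = (numq (y k j))%:~R.
  by rewrite pmulrn absz_denq mulrC numqE.
by rewrite rpredM ?natr_int ?intr_int.
Qed.

Definition affinely_independent (R : realType) (n k : nat)
    (v : 'I_k.+1 -> 'cV[R]_n) : Prop :=
  forall a : 'I_k.+1 -> R,
    \sum_i a i = 0 -> \sum_i a i *: v i = 0 -> forall i, a i = 0.

Definition Zbasis (m : nat) (b : 'I_m -> 'cV[int]_m) : Prop :=
  forall w : 'cV[int]_m, exists! a : {ffun 'I_m -> int},
    w = \sum_i a i *: b i.

(** A k-simplex conv(v_0, ..., v_k) is given by its listed vertices. *)
Definition regular_simplex (R : realType) (n k : nat)
    (v : 'I_k.+1 -> 'cV[rat]_n) : Prop :=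
  affinely_independent (fun i => ratpt R (v i)) /\
  exists (b : 'I_(n + 1) -> 'cV[int]_(n + 1)) (f : 'I_k.+1 -> 'I_(n + 1)),
    [/\ Zbasis b, injective f & forall i, b (f i) = homog (v i)].

(** * Rational affine spaces and the integer c_x *)

Definition rational_hyperplane (R : realType) (n : nat) (H : set 'cV[R]_n) : Prop :=
  exists (h : 'cV[rat]_n) (k : rat),
    h != 0 /\ H = [set z | \sum_i ratr (h i 0) * z i 0 = ratr k].

Definition Fspace (R : realType) (n : nat) (x : 'cV[R]_n) : set 'cV[R]_n :=
  \bigcap_(H in [set H | rational_hyperplane H /\ H x]) H.

(** [F] is a translate of the e-dimensional column space of [B]. *)
Definition affine_dim (R : realType) (n : nat) (F : set 'cV[R]_n) (e : nat) : Prop :=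
  exists (p : 'cV[R]_n) (B : 'M[R]_(n, e)),
    \rank B = e /\ F = [set p + B *m u | u in [set: 'cV[R]_e]].

Definition vertex_den (R : realType) (n : nat) (F : set 'cV[R]_n) : set nat :=
  [set m | exists (e : nat) (v : 'I_n.+1 -> 'cV[rat]_n),
     [/\ affine_dim F e,
         regular_simplex R v,
         forall i : 'I_n.+1, (i <= e)%N -> F (ratpt R (v i))
       & exists i, m = den (v i)]].

(** The least element of [vertex_den F]; the default 0 is only returned when
    that set is empty. *)
Definition c_aff (R : realType) (n : nat) (F : set 'cV[R]_n) : nat :=
  xget 0%N [set m | vertex_den F m /\ forall m', vertex_den F m' -> (m <= m')%N].

Definition c_pt (R : realType) (n : nat) (x : 'cV[R]_n) : nat :=
  c_aff (Fspace x).

(* Main.v *)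
Require Import Defs.
From HB Require Import structures.
From mathcomp Require Import all_boot all_order all_algebra.
From mathcomp Require Import all_classical all_reals.
From mathcomp Require Import ring zify.

(** Integer affine maps preserve both invariants: G_x because the coordinates
    of Ux + t are integer combinations of 1 and the coordinates of x, and c_x
    because such a map carries rational hyperplanes, denominators and regular
    simplexes to objects of the same kind ([Ggrp_orb], [c_pt_orb]).

    For the converse, the relations between 1, x_1 and x_2 over the integers
    decide how much of x is already visible in G_x.

    If there is no relation, then (1, x_1, x_2) is a basis of G_x. When
    G_x = G_x', the coordinates of each point are integer affine functions of
    those of the other, and the two affine maps are mutually inverse because
    coordinates on a basis are unique ([orb_int_independent]).

    If there is a relation, Bezout gives a unimodular matrix which carries x
    to a point (a, p/q) with p/q in lowest terms ([orb_rational_line]).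

    If moreover a is rational, then x is equivalent to (1/D, 0), and D is
    recovered from G_x, which is generated by 1/D ([orb_rational]).

    If a is irrational, the only rational line through (a, p/q) is the
    horizontal one, F_x. The rational numbers in G_x form (1/q)Z, so G_x
    determines q, and it determines a up to sign modulo Z + Z p/q. What it
    does not determine is the class of p modulo q up to sign, and this is the
    content of c_x. Indeed the form (y_1, y_2, y_3) |-> q y_2 - p y_3 vanishes
    on the homogeneous correspondents of the two vertices of a regular triangle
    that lie on F_x, and takes the value 1 somewhere, so it takes one of the
    values 1 and -1 on that of the third vertex. The denominator c of the third
    vertex thus satisfies c p = 1 or -1 modulo q, while the other two
    denominators are multiples of q. All positive c with c p = 1 modulo q
    occur, and one of them is at most q, so the minimum c_x satisfies
    c_x p = 1 or -1 modulo q ([c_pt_hline]). Equality of the c's then gives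
    p' = p or -p modulo q, from which the equivalence is written down
    ([orb_line]). *)

Set Implicit Arguments.
Unset Strict Implicit.
Unset Printing Implicit Defensive.

Import Order.TTheory GRing.Theory Num.Theory.

Local Open Scope classical_set_scope.
Local Open Scope ring_scope.

(** * Unimodular affine maps and orbits *)

Definition pm1 (a : int) : Prop := a = 1 \/ a = -1.

Lemma pm1M (a b : int) : pm1 a -> pm1 b -> pm1 (a * b).
Proof.
by case=> -> [] ->; rewrite ?mulrNN ?mul1r ?mulr1; [left | right | right | left].
Qed.

Lemma pm1_mulr_eq1 (a b : int) : a * b = 1 -> pm1 a.
Proof.
move=> ab1.
have : (`|a| * `|b| == 1)%N by rewrite -abszM ab1.
rewrite muln_eq1 => /andP[/eqP a1 _].
by case: (intP a) a1 => //= n [->]; [left | right].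
Qed.

Lemma unimodular_inv (n : nat) (U : 'M[int]_n) :
  pm1 (\det U) ->
  exists V : 'M[int]_n,
    [/\ V *m U = 1%:M, U *m V = 1%:M & pm1 (\det V)].
Proof.
move=> dU; have uU : U \in unitmx.
  by rewrite unitmxE; case: dU => ->; rewrite ?unitrN unitr1.
exists (invmx U); split; [exact: mulVmx | exact: mulmxV |].
apply: (@pm1_mulr_eq1 _ (\det U)).
by rewrite -det_mulmx mulVmx // det1.
Qed.

(** Stated over any ring, since the same integer map acts on real points
    and on the rational vertices of simplexes. *)
Definition affmap (T : pzRingType) (n : nat) (U : 'M[int]_n) (t : 'cV[int]_n)
    (x : 'cV[T]_n) : 'cV[T]_n :=
  map_mx intr U *m x + map_mx intr t.

Lemma affmapK (T : pzRingType) (n : nat) (U V : 'M[int]_n) (t : 'cV[int]_n) :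
  V *m U = 1%:M -> cancel (@affmap T n U t) (affmap V (- (V *m t))).
Proof.
move=> VU x; rewrite /affmap mulmxDr mulmxA -map_mxM VU map_mx1 mul1mx.
by rewrite map_mxN map_mxM addrK.
Qed.

Section Orbits.
Variables (R : realType) (n : nat).
Implicit Types x y z : 'cV[R]_n.

Lemma orbP x y :
  orb x y <-> exists (U : 'M[int]_n) (t : 'cV[int]_n),
    pm1 (\det U) /\ y = affmap U t x.
Proof.
split=> [[_ [U [t [dU ->]]] <-] | [U [t [dU ->]]]]; first by exists U, t.
by exists (affmap U t) => //; exists U, t.
Qed.

Lemma orb_refl x : orb x x.
Proof.
apply/orbP; exists 1%:M, 0; split; first by left; rewrite det1.
by rewrite /affmap map_mx1 mul1mx map_mx0 addr0.
Qed.

Lemma orb_sym x y : orb x y -> orb y x.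
Proof.
move=> /orbP[U [t [dU ->]]]; have [V [VU _ dV]] := unimodular_inv dU.
by apply/orbP; exists V, (- (V *m t)); split; rewrite ?affmapK.
Qed.

Lemma orb_trans y x z : orb x y -> orb y z -> orb x z.
Proof.
move=> /orbP[U [t [dU ->]]] /orbP[U' [t' [dU' ->]]]; apply/orbP.
exists (U' *m U), (U' *m t + t'); split.
  by rewrite det_mulmx; apply: pm1M.
by rewrite /affmap map_mxD !map_mxM mulmxDr mulmxA addrA.
Qed.

Lemma orb_eq x y : orb x = orb y <-> orb x y.
Proof.
split=> [-> | xy]; first exact: orb_refl.
by apply/seteqP; split=> z; apply: orb_trans => //; apply: orb_sym.
Qed.

Lemma Ggrp_orb_sub x y : orb x y -> Ggrp y `<=` Ggrp x.
Proof.
move=> /orbP[U [t [_ ->]]] _ [k [h ->]].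
exists (k + \sum_i h i * t i 0), (fun j => \sum_i h i * U i j).
rewrite rmorphD /= rmorph_sum /= -addrA; congr (_ + _).
under eq_bigr do rewrite !mxE mulrDr.
rewrite big_split /= addrC; congr (_ + _).
  by apply: eq_bigr => i _; rewrite rmorphM.
under [RHS]eq_bigr do rewrite rmorph_sum mulr_suml.
rewrite [RHS]exchange_big /=; apply: eq_bigr => i _.
rewrite mulr_sumr; apply: eq_bigr => j _.
by rewrite !mxE rmorphM mulrA.
Qed.

Lemma Ggrp_orb x y : orb x y -> Ggrp x = Ggrp y.
Proof.
by move=> xy; apply/seteqP; split; apply: Ggrp_orb_sub => //; apply: orb_sym.
Qed.

End Orbits.

(** * Invariance of the integer c_x *)

Section Denominators.
Variable n : nat.
Implicit Types (U V : 'M[int]_n) (t : 'cV[int]_n) (y : 'cV[rat]_n).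

Lemma mulr_denq_int (m : nat) (q : rat) :
  (`|denq q| %| m)%N <-> m%:R * q \is a Num.int.
Proof.
split=> [/dvdnP[k ->] | /intrP[z mq]].
  rewrite natrM -mulrA [_ * q]mulrC.
  rewrite (_ : (`|denq q|)%:R = (denq q)%:~R :> rat); last first.
    by rewrite pmulrn absz_denq.
  by rewrite -numqE rpredM ?natr_int ?intr_int.
have: (m%:Z * numq q)%:~R = (z * denq q)%:~R :> rat.
  by rewrite !rmorphM /= -mq numqE pmulrn mulrA.
move/intr_inj => /(congr1 absz); rewrite !abszM /= => e.
rewrite -(@Gauss_dvdl _ _ `|numq q|) ?e ?dvdn_mull //.
by rewrite coprime_sym coprime_num_den.
Qed.

Lemma dvdn_den (m : nat) (y : 'cV[rat]_n) :
  (den y %| m)%N <-> forall i, m%:R * y i 0 \is a Num.int.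
Proof.
split=> [/dvdn_biglcmP h i | h]; first exact/mulr_denq_int/h.
by apply/dvdn_biglcmP => i _; apply/mulr_denq_int.
Qed.

Lemma den_affmap_dvd U t y : (den (affmap U t y) %| den y)%N.
Proof.
apply/dvdn_den => i; rewrite !mxE mulrDr rpredD //; last first.
  by rewrite rpredM ?natr_int ?intr_int.
rewrite mulr_sumr rpred_sum // => j _.
rewrite mxE mulrCA rpredM ?intr_int //.
by apply: (proj1 (dvdn_den (den y) y)).
Qed.

(** Integer affine maps can only decrease denominators for divisibility; the
    inverse map gives the reverse divisibility. *)
Lemma den_affmap U t y : pm1 (\det U) -> den (affmap U t y) = den y.
Proof.
move=> /unimodular_inv[V [VU _ _]]; apply/eqP.
rewrite eqn_dvd den_affmap_dvd /=.
by rewrite -{1}(affmapK t VU y) den_affmap_dvd.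
Qed.

(** The linear action of x |-> Ux + t on homogeneous coordinates (x, 1). *)
Definition affh (U : 'M[int]_n) (t : 'cV[int]_n) : 'M[int]_(n + 1) :=
  block_mx U t 0 1%:M.

Lemma map_intr_inj (m k : nat) :
  injective (map_mx intr : 'M[int]_(m, k) -> 'M[rat]_(m, k)).
Proof.
move=> A B /matrixP AB; apply/matrixP => i j.
by have := AB i j; rewrite !mxE => /intr_inj.
Qed.

Lemma den_gt0 y : (0 < den y)%N.
Proof.
rewrite /den; elim/big_ind: _ => // [m k m0 k0 | i _]; first by rewrite lcmn_gt0 m0.
by rewrite absz_gt0 denq_neq0.
Qed.

Lemma homog_coord y i :
  (homog y (lshift 1 i) 0)%:~R = (den y)%:R * y i 0.
Proof.
have /colP/(_ (lshift 1 i)) := homogE y.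
by rewrite mxE => ->; rewrite mxE col_mxEu.
Qed.

Lemma homog_last y : homog y (rshift n 0) 0 = den y.
Proof.
apply: (@intr_inj rat).
have /colP/(_ (rshift n 0)) := homogE y.
by rewrite mxE => ->; rewrite mxE col_mxEd mxE mulr1.
Qed.

Lemma homog_affmap U t y : pm1 (\det U) ->
  homog (affmap U t y) = affh U t *m homog y.
Proof.
move=> dU; apply: map_intr_inj.
rewrite map_mxM !homogE den_affmap // -scalemxAr; congr (_ *: _).
rewrite map_block_mx map_mx0 map_mx1 mul_block_col mul0mx /affmap.
congr col_mx; first congr (_ + _); apply/matrixP => i j;
  by rewrite ?mxE ?add0r big_ord1 !mxE ?mulr1 ?(ord1 i) ?(ord1 j).
Qed.

Lemma affh_inv (U V : 'M[int]_n) (t : 'cV[int]_n) : V *m U = 1%:M ->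
  affh V (- (V *m t)) *m affh U t = 1%:M.
Proof.
move=> VU; rewrite /affh mulmx_block !mul0mx !mulmx0 !mulmx1 VU.
by rewrite addr0 addrN !add0r -scalar_mx_block.
Qed.
End Denominators.

Lemma Zbasis_mul (m : nat) (M N : 'M[int]_m) (b : 'I_m -> 'cV[int]_m) :
  M *m N = 1%:M -> N *m M = 1%:M -> Zbasis b -> Zbasis (fun i => M *m b i).
Proof.
move=> MN NM bb w.
have E (a : 'I_m -> int) : \sum_i a i *: (M *m b i) = M *m \sum_i a i *: b i.
  by rewrite mulmx_sumr; apply: eq_bigr => i _; rewrite scalemxAr.
have [a [wa ua]] := bb (N *m w); exists a; split.
  by rewrite E -wa mulmxA MN mul1mx.
by move=> a' wa'; apply: ua; rewrite wa' E mulmxA NM mul1mx.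
Qed.

Section Invariance.
Variables (R : realType) (n : nat).
Implicit Types (x z : 'cV[R]_n) (F : set 'cV[R]_n).

Lemma ratpt_affmap U t (y : 'cV[rat]_n) : ratpt R (affmap U t y) = affmap U t (ratpt R y).
Proof.
rewrite /ratpt /affmap map_mxD map_mxM.
by congr (_ *m _ + _); apply/matrixP => i j; rewrite !mxE /= ratr_int.
Qed.

Lemma unimodular_unitmx (U : 'M[int]_n) : pm1 (\det U) ->
  map_mx intr U \in unitmx (R := R).
Proof.
move=> /unimodular_inv[V [_ UV _]].
apply: (proj1 (mulmx1_unit (A := map_mx intr U) (B := map_mx intr V) _)).
by rewrite -map_mxM UV map_mx1.
Qed.

(** The preimage under an integer affine map of the rational hyperplane
    h.z = k is the rational hyperplane (U^T h).z = k - h.t. *)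
Lemma Fspace_affmap U t x z : pm1 (\det U) ->
  Fspace x z -> Fspace (affmap U t x) (affmap U t z).
Proof.
move=> dU Fz _ [[h [k [h0 ->]]] /=].
pose h' : 'cV[rat]_n := map_mx intr U^T *m h.
pose k' := k - \sum_i h i 0 * (t i 0)%:~R.
have E u : \sum_i ratr (h i 0) * affmap U t u i 0 =
    \sum_i ratr (h' i 0) * u i 0 + ratr (k - k') :> R.
  rewrite [k - k'](_ : _ = \sum_i h i 0 * (t i 0)%:~R) ?subKr // rmorph_sum /=.
  under eq_bigr do rewrite !mxE mulrDr.
  rewrite big_split /=; congr (_ + _); last first.
    by apply: eq_bigr => i _; rewrite rmorphM /= ratr_int.
  under [RHS]eq_bigr do rewrite mxE rmorph_sum mulr_suml.
  rewrite [RHS]exchange_big /=; apply: eq_bigr => i _.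
  rewrite mulr_sumr; apply: eq_bigr => j _.
  by rewrite !mxE rmorphM /= ratr_int mulrA [ratr _ * _]mulrC.
have E' u : (\sum_i ratr (h i 0) * affmap U t u i 0 = ratr k :> R) <->
    (\sum_i ratr (h' i 0) * u i 0 = ratr k' :> R).
  rewrite E; split=> [/(canRL (addrK _)) -> | ->].
    by rewrite -rmorphB /= subKr.
  by rewrite -rmorphD /= addrC subrK.
rewrite E' => hx; rewrite E'.
apply: (Fz [set u | \sum_i ratr (h' i 0) * u i 0 = ratr k']).
split=> //; exists h', k'; split=> //.
apply: contra_neq h0 => h'0.
have [V [_ UV _]] := unimodular_inv dU.
rewrite -[h]mul1mx -(map_mx1 (intr : int -> rat)) -(trmx1 _ n) -UV trmx_mul.
by rewrite map_mxM -mulmxA -/h' h'0 mulmx0.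
Qed.

Lemma Fspace_affmapE U t x : pm1 (\det U) ->
  Fspace (affmap U t x) = [set affmap U t z | z in Fspace x].
Proof.
move=> dU; have [V [VU UV dV]] := unimodular_inv dU.
apply/seteqP; split=> [z Fz | _ [z Fz <-]]; last exact: Fspace_affmap.
exists (affmap V (- (V *m t)) z).
  by rewrite -(affmapK t VU x); apply: Fspace_affmap.
rewrite /affmap mulmxDr mulmxA -map_mxM UV map_mx1 mul1mx.
by rewrite map_mxN !map_mxM mulmxN mulmxA -map_mxM UV map_mx1 mul1mx subrK.
Qed.

Lemma affine_dim_affmap U t F e : pm1 (\det U) ->
  affine_dim F e -> affine_dim [set affmap U t z | z in F] e.
Proof.
move=> dU [p [B [rB ->]]]; exists (affmap U t p), (map_mx intr U *m B); split.
  rewrite -mxrank_tr trmx_mul mxrankMfree ?mxrank_tr //.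
  by rewrite row_free_unit unitmx_tr unimodular_unitmx.
apply/seteqP; split=> [_ [_ [u _ <-] <-] | _ [u _ <-]].
  by exists u => //; rewrite /affmap mulmxDr mulmxA addrAC.
exists (p + B *m u); first by exists u.
by rewrite /affmap mulmxDr mulmxA addrAC.
Qed.

Lemma regular_simplex_affmap U t k (v : 'I_k.+1 -> 'cV[rat]_n) :
  pm1 (\det U) ->
  regular_simplex R v -> regular_simplex R (fun i => affmap U t (v i)).
Proof.
move=> dU [vind [b [f [bb fi bf]]]]; have [V [VU UV dV]] := unimodular_inv dU.
split=> [a a0 av|].
  apply: vind => //.
  have: map_mx intr U *m (\sum_i a i *: ratpt R (v i)) = 0.
    rewrite -[RHS]av mulmx_sumr.
    under [RHS]eq_bigr do rewrite ratpt_affmap /affmap scalerDr scalemxAr.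
    by rewrite big_split /= -scaler_suml a0 scale0r addr0.
  move/(congr1 (mulmx (map_mx intr V))).
  by rewrite mulmx0 mulmxA -map_mxM VU map_mx1 mul1mx.
exists (fun i => affh U t *m b i), f; split=> // [|i].
  apply: (@Zbasis_mul _ _ (affh V (- (V *m t)))) => //; last exact: affh_inv.
  have := affh_inv (- (V *m t)) UV.
  by rewrite mulmxN mulmxA UV mul1mx opprK.
by rewrite bf homog_affmap.
Qed.

Lemma vertex_den_orb_sub x y : orb x y ->
  vertex_den (Fspace x) `<=` vertex_den (Fspace y).
Proof.
move=> /orbP[U [t [dU ->]]] m [e [v [Fe rv Fv [i ->]]]].
rewrite -/(affmap U t x) Fspace_affmapE //.
exists e, (fun i => affmap U t (v i)); split.
- exact: affine_dim_affmap.
- exact: regular_simplex_affmap.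
- by move=> j je; exists (ratpt R (v j)); [exact: Fv | rewrite ratpt_affmap].
- by exists i; rewrite den_affmap.
Qed.

Lemma c_pt_orb x y : orb x y -> c_pt x = c_pt y.
Proof.
move=> xy; rewrite /c_pt /c_aff.
suff -> : vertex_den (Fspace x) = vertex_den (Fspace y) by [].
by apply/seteqP; split; apply: vertex_den_orb_sub => //; apply: orb_sym.
Qed.

Lemma c_pt_min x m0 : vertex_den (Fspace x) m0 ->
  vertex_den (Fspace x) (c_pt x) /\ (c_pt x <= m0)%N.
Proof.
move=> Fm0; rewrite /c_pt /c_aff.
have ex : exists m, `[< vertex_den (Fspace x) m >] by exists m0; apply/asboolP.
have [m /asboolP Fm mmin] := ex_minnP ex.
have := @xgetPex _ 0%N [set m | vertex_den (Fspace x) m /\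
  forall m', vertex_den (Fspace x) m' -> (m <= m')%N].
case; first by exists m; split=> // m' Fm'; apply/mmin/asboolP.
by split=> //; auto.
Qed.

End Invariance.

(** * Points whose coordinates are independent with 1 *)

Section Generic.
Variables (R : realType) (n : nat).
Implicit Types x y : 'cV[R]_n.

Definition int_independent x := forall (k : int) (h : 'I_n -> int),
  k%:~R + \sum_i (h i)%:~R * x i 0 = 0 -> forall i, h i = 0.

Lemma Ggrp_coord x i : Ggrp x (x i 0).
Proof.
exists 0, (fun j => (j == i)%:Z); rewrite add0r (bigD1 i) //= eqxx mul1r.
by rewrite big1 ?addr0 // => j /negPf ->; rewrite mul0r.
Qed.

Lemma Ggrp_sub_affmap x y : Ggrp y `<=` Ggrp x ->
  exists U t, y = affmap U t x.
Proof.
move=> yx.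
have /choice[f fP] i : exists p : int * ('I_n -> int),
    y i 0 = p.1%:~R + \sum_j (p.2 j)%:~R * x j 0.
  by have [k [h ->]] := yx _ (Ggrp_coord y i); exists (k, h).
exists (\matrix_(i, j) (f i).2 j), (\col_i (f i).1).
apply/colP => i; rewrite fP !mxE addrC; congr (_ + _).
by apply: eq_bigr => j _; rewrite !mxE.
Qed.

(** Composing the two integer affine maps that express the coordinates of
    each point through those of the other gives an integer relation for x,
    which must be trivial: the linear parts are mutually inverse. *)
Lemma orb_int_independent x y : int_independent x -> Ggrp x = Ggrp y -> orb x y.
Proof.
move=> xind xy.
have [|U [t yE]] := @Ggrp_sub_affmap x y; first by rewrite xy.
have [|V [s xE]] := @Ggrp_sub_affmap y x; first by rewrite xy.
have VU : V *m U = 1%:M.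
  apply/matrixP => i j; apply/eqP; rewrite -subr_eq0; apply/eqP; move: j.
  apply: (xind ((V *m t + s) i 0)).
  have : affmap (V *m U - 1%:M) (V *m t + s) x = 0.
    rewrite /affmap map_mxB map_mx1 mulmxBl mul1mx addrAC.
    apply/eqP; rewrite subr_eq0 [in eqbRHS]xE yE /affmap.
    by rewrite mulmxDr mulmxA -!map_mxM -addrA map_mxD.
  move/matrixP/(_ i 0); rewrite !mxE addrC => {2}<-; congr (_ + _).
  by apply: eq_bigr => j _; rewrite !mxE.
apply/orbP; exists U, t; split=> //.
by apply: (@pm1_mulr_eq1 _ (\det V)); rewrite mulrC -det_mulmx VU det1.
Qed.

End Generic.

(** * Normal forms in the plane *)

Lemma sum_I2 (V : nmodType) (F : 'I_2 -> V) : \sum_i F i = F 0 + F 1.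
Proof. by rewrite !big_ord_recl big_ord0 addr0; congr (_ + F _); apply/val_inj. Qed.

Lemma sum_I3 (V : nmodType) (F : 'I_3 -> V) : \sum_i F i = F 0 + F 1 + F 2%:R.
Proof.
rewrite !big_ord_recl big_ord0 addr0 addrA.
by congr (_ + F _ + F _); apply/val_inj.
Qed.

Lemma bezout_num_den (r : rat) : exists u v : int, u * numq r + v * denq r = 1.
Proof.
have [u [v uv]] := Bezoutz (numq r) (denq r); exists u, v.
by rewrite uv /gcdz (eqP (coprime_num_den r)).
Qed.

Section Plane.

Definition pt2 (T : Type) (a b : T) : 'cV[T]_2 := \col_i (if i == 0 then a else b).

Lemma pt2_eta (T : Type) (x : 'cV[T]_2) : x = pt2 (x 0 0) (x 1 0).
Proof.
apply/colP => i; rewrite mxE; case: eqP => [-> // | /eqP i0].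
by congr (x _ _); apply/val_inj; case: i i0 => [[|[|]]].
Qed.

Lemma det_mx22 (T : comPzRingType) (A : 'M[T]_2) :
  \det A = A 0 0 * A 1 1 - A 0 1 * A 1 0.
Proof.
rewrite (expand_det_row _ 0) !big_ord_recl big_ord0 /cofactor !det_mx11 !mxE /=.
rewrite (_ : lift 0 0 = 1); last exact/val_inj.
rewrite (_ : lift 1 0 = 0); last exact/val_inj.
by rewrite !expr0 expr1 mul1r mulN1r mulrN addr0.
Qed.

Variable R : realType.
Implicit Types a b : R.

Lemma orb_pt2 (u v w z s t : int) a b :
  pm1 (u * z - v * w) ->
  orb (pt2 a b)
    (pt2 (u%:~R * a + v%:~R * b + s%:~R) (w%:~R * a + z%:~R * b + t%:~R)).
Proof.
move=> d; apply/orbP.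
exists (\matrix_(i, j) if i == 0 then pt2 u v j 0 else pt2 w z j 0), (pt2 s t).
rewrite det_mx22 !mxE /=; split=> //.
by apply/colP => i; rewrite !mxE sum_I2 !mxE /=; case: eqP.
Qed.

Lemma Ggrp_pt2 a b r :
  Ggrp (pt2 a b) r <-> exists k h l : int, r = k%:~R + h%:~R * a + l%:~R * b.
Proof.
split=> [[k [h ->]] | [k [h [l ->]]]].
  by exists k, (h 0), (h 1); rewrite sum_I2 !mxE addrA.
by exists k, (fun i => if i == 0 then h else l); rewrite sum_I2 !mxE addrA.
Qed.

Lemma Ggrp_fst a b : Ggrp (pt2 a b) a.
Proof. by have := Ggrp_coord (pt2 a b) 0; rewrite mxE. Qed.

(** Bezout completes the primitive vector (h1, h2)/gcd to a unimodular
    matrix having it as second row. *)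
Lemma orb_second_coord (h1 h2 : int) a b : h1 != 0 \/ h2 != 0 ->
  exists u v g : int, g != 0 /\
   orb (pt2 a b)
     (pt2 (u%:~R * a + v%:~R * b) ((h1%:~R * a + h2%:~R * b) / g%:~R)).
Proof.
move=> h0; set g := gcdz h1 h2.
have g0 : g != 0 by rewrite gcdz_eq0 negb_and; apply/orP.
have gR0 : g%:~R != 0 :> R by rewrite intr_eq0.
have [u [v uv]] := Bezoutz h1 h2.
have /dvdzP[m1 e1] := dvdz_gcdl h1 h2; have /dvdzP[m2 e2] := dvdz_gcdr h1 h2.
rewrite -/g in uv e1 e2.
have uvm : v * m2 - (- u) * m1 = 1.
  by apply: (mulIf g0); rewrite mul1r -[RHS]uv [in RHS]e1 [in RHS]e2; ring.
exists v, (- u), g; split=> //.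
have := @orb_pt2 v (- u) m1 m2 0 0 a b (or_introl uvm); rewrite !addr0.
by congr (orb _ (pt2 _ _)); rewrite e1 e2 !rmorphM /=; field.
Qed.

Lemma orb_rational_line (x : 'cV[R]_2) : ~ int_independent x ->
  exists a (r : rat), orb x (pt2 a (ratr r)).
Proof.
rewrite {2}[x]pt2_eta => /existsNP[k /existsNP[h /not_implyP[hx /existsNP[i /eqP hi]]]].
have h0 : h 0 != 0 \/ h 1 != 0.
  case: (eqVneq i 0) hi => [-> | i0 hi]; first by left.
  by right; rewrite (_ : 1 = i) //; apply/val_inj; case: i i0 {hi} => [[|[|]]].
have [u [v [g [_ xa]]]] := orb_second_coord (x 0 0) (x 1 0) h0.
exists (u%:~R * x 0 0 + v%:~R * x 1 0), (- k%:~R / g%:~R).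
move: xa; congr (orb _ (pt2 _ _)).
rewrite rmorphM rmorphN fmorphV /= !ratr_int; congr (_ / _).
by apply/eqP; rewrite -addr_eq0 addrC -hx sum_I2.
Qed.

(** A rational point lies on a line through 0 with integer coefficients, so
    it is equivalent to some (N/D, 0) in lowest terms; a Bezout identity for N
    and D then moves it to (1/D, 0). *)
Lemma orb_ratpt (s r : rat) : exists D : int, 0 < D /\
  orb (pt2 (ratr s) (ratr r) : 'cV[R]_2) (pt2 (D%:~R^-1) 0).
Proof.
have dR (p : rat) : (denq p)%:~R != 0 :> R by rewrite intr_eq0 denq_neq0.
have ratrE (p : rat) : ratr p = (numq p)%:~R / (denq p)%:~R :> R by [].
have [q qxy] : exists q : rat, orb (pt2 (ratr s) (ratr r) : 'cV[R]_2) (pt2 (ratr q) 0).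
  (* For s = 0, which includes the origin, exchange the coordinates; otherwise
     the form with coefficients num(r) den(s) and - num(s) den(r) is nonzero
     and vanishes at (s, r). *)
  have [s0 | s0] := eqVneq s 0.
    exists r; have := @orb_pt2 0 1 1 0 0 0 (ratr s) (ratr r).
    rewrite s0 rmorph0 !mulr0 !mul0r !add0r !addr0 !mul1r; apply; by right.
  have [|u [v [g [_ xa]]]] :=
    @orb_second_coord (numq r * denq s) (- (numq s * denq r)) (ratr s) (ratr r).
    by right; rewrite oppr_eq0 mulf_neq0 ?denq_neq0 // numq_eq0.
  exists (u%:~R * s + v%:~R * r); move: xa; congr (orb _ (pt2 _ _)).
    by rewrite rmorphD !rmorphM /= !ratr_int.
  rewrite [X in X / _](_ : _ = 0) ?mul0r // !ratrE !rmorphM /= rmorphN !rmorphM /=.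
  by field; rewrite !dR.
have [u [v uv]] := bezout_num_den q.
exists (denq q); split; first exact: denq_gt0.
apply: orb_trans qxy _.
have uv' : u * numq q - (- v) * denq q = 1 by rewrite -uv; ring.
have := @orb_pt2 u (- v) (denq q) (numq q) v (- numq q) (ratr q) 0 (or_introl uv').
have uvR : u%:~R * (numq q)%:~R + v%:~R * (denq q)%:~R = 1 :> R.
  by rewrite -!rmorphM -rmorphD uv.
have dq := dR q; congr (orb _ (pt2 _ _)); rewrite !ratrE rmorphN; last by field.
by apply: (mulIf dq); rewrite mulVf // -[RHS]uvR; field.
Qed.

End Plane.

(** * The integer c_x on a horizontal line of rational height *)

Section Line.
Variable R : realType.

Definition hline (r : rat) : set 'cV[R]_2 := [set z | z 1 0 = ratr r].

Definition irrational (a : R) := forall s : rat, a <> ratr s.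

Lemma irrational_mul_eq0 (a : R) (s r : rat) :
  irrational a -> ratr s * a = ratr r -> s = 0.
Proof.
move=> irr e; apply: contrapT => /eqP s0; apply: (irr (r / s)).
have sR : ratr s != 0 :> R by rewrite fmorph_eq0.
by rewrite rmorphM fmorphV /= -e mulrAC mulfV ?mul1r.
Qed.

(** A rational hyperplane h_1 z_1 + h_2 z_2 = k through (a, r) has h_1 = 0,
    as a would otherwise be rational; hence it contains the whole line. *)
Lemma Fspace_hline a r : irrational a -> Fspace (pt2 a (ratr r)) = hline r.
Proof.
move=> irr; apply/seteqP; split=> [z Fz | z zr].
  have E u : \sum_i ratr ((pt2 0 1 : 'cV[rat]_2) i 0) * u i 0 = u 1 0 :> R.
    by rewrite sum_I2 !mxE /= rmorph0 rmorph1 mul0r mul1r add0r.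
  rewrite /hline /= -E; apply: (Fz [set u |
    \sum_i ratr ((pt2 0 1 : 'cV[rat]_2) i 0) * u i 0 = ratr r]).
  split; last by rewrite /= E mxE.
  exists (pt2 0 1), r; split=> //; apply/eqP => /colP/(_ 1); rewrite !mxE /=.
  by move/eqP; rewrite oner_eq0.
move=> H [[h [k [_ ->]]]] /=; rewrite (pt2_eta z) zr.
rewrite !sum_I2 !mxE /= => e; have h0 : h 0 0 = 0.
  apply: (@irrational_mul_eq0 a _ (k - h 1 0 * r) irr).
  by rewrite rmorphB rmorphM /= -e addrK.
by move: e; rewrite h0 rmorph0 !mul0r.
Qed.

Lemma affine_dim_hline_gt0 r e : affine_dim (hline r) e -> (0 < e)%N.
Proof.
case: e => // -[p [B [_ E]]].
have P (s : R) : pt2 s (ratr r) = p.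
  have : hline r (pt2 s (ratr r)) by rewrite /hline /= mxE.
  by rewrite E => -[u _ <-]; rewrite [u]flatmx0 mulmx0 addr0.
have := P 0; rewrite -(P 1) => /colP/(_ 0); rewrite !mxE /= => /eqP.
by rewrite eq_sym oner_eq0.
Qed.

Lemma affine_dim_hline r : affine_dim (hline r) 1.
Proof.
exists (pt2 0 (ratr r)), (pt2 1 0); split.
  apply/eqP; rewrite eqn_leq rank_leq_col lt0n mxrank_eq0.
  apply/eqP => /colP/(_ 0); rewrite !mxE /= => /eqP.
  by rewrite oner_eq0.
apply/seteqP; split=> [z zr | _ [u _ <-]].
  exists (const_mx (z 0 0)) => //; rewrite [RHS]pt2_eta zr.
  apply/colP => i; rewrite !mxE big_ord1 !mxE.
  by case: eqP; rewrite ?mul1r ?mul0r ?add0r ?addr0.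
by rewrite /hline /= !mxE big_ord1 !mxE /= mul0r addr0.
Qed.

(** A primitive integer form whose kernel contains the homogeneous
    correspondents of all rational points of [hline r]. *)
Definition line_form (r : rat) (w : 'cV[int]_(2 + 1)) : int :=
  denq r * w (lshift 1 1) 0 - numq r * w (rshift 2 0) 0.

Lemma line_form_homog r (y : 'cV[rat]_2) : ratpt R y \in hline r ->
  line_form r (homog y) = 0.
Proof.
rewrite inE /hline /= mxE => /(fmorph_inj (@ratr R)) yr.
apply: (@intr_inj rat); rewrite /line_form rmorphB !rmorphM /= homog_coord homog_last yr.
by rewrite numqE -pmulrn; ring.
Qed.

Lemma line_form_sum r m (a : 'I_m -> int) (b : 'I_m -> 'cV[int]_(2 + 1)) :
  line_form r (\sum_i a i *: b i) = \sum_i a i * line_form r (b i).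
Proof.
rewrite /line_form !summxE !mulr_sumr -sumrB; apply: eq_bigr => i _.
by rewrite !mxE; ring.
Qed.

(** Evaluate [line_form r] on a basis containing the homogeneous vertices.
    It vanishes at the vertices 0 and 1, which lie on the line, and it is onto,
    so its value at vertex 2 is a unit. Vanishing at vertices 0 and 1 makes the
    denominator of r divide theirs, by coprimality. *)
Lemma vertex_den_hline r m : vertex_den (hline r) m ->
  (0 < m)%N /\ ((denq r %| m%:Z)%Z \/
  exists k : int, pm1 (m%:Z * numq r - denq r * k)).
Proof.
move=> [e [v [/affine_dim_hline_gt0 e0 [_ [b [f [bb fi bf]]]] Fv [i ->]]]].
split; first exact: den_gt0.
have Fv0 (j : 'I_3) : (j <= 1)%N -> line_form r (homog (v j)) = 0.
  by move=> j1; apply/line_form_homog/mem_set/Fv/(leq_trans j1).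
have [i1 | i1] := leqP i 1.
  left; have := Fv0 i i1; rewrite /line_form homog_last => /eqP.
  rewrite subr_eq0 => /eqP h.
  rewrite -(@Gauss_dvdzr _ (numq r)) -?h ?dvdz_mulr //.
  by rewrite coprimezE coprime_sym coprime_num_den.
right; exists (homog (v i) (lshift 1 1) 0).
have [u [w uw]] := bezout_num_den r.
have [a [wa _]] := bb (col_mx (pt2 0 w) (const_mx (- u))).
have : line_form r (col_mx (pt2 0 w) (const_mx (- u))) = 1.
  by rewrite /line_form col_mxEu col_mxEd !mxE /= -uw; ring.
rewrite wa line_form_sum (reindex f) /=; last first.
  have /injF_bij [g gf fg] : injective (f : 'I_3 -> 'I_3) by [].
  by exists g => x _.
rewrite (bigD1 i) //= big1 ?addr0 => [|j ji]; last first.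
  rewrite bf Fv0 ?mulr0 //; have := ltn_ord i; have := ltn_ord j.
  by move: ji; rewrite -val_eqE /=; lia.
rewrite bf mulrC => /pm1_mulr_eq1; rewrite /line_form homog_last.
case=> h; [right | left]; apply: oppr_inj; last by rewrite -h; ring.
by rewrite opprK -[RHS]h; ring.
Qed.

Definition pt3 (x y z : int) : 'cV[int]_(2 + 1) := col_mx (pt2 x y) (const_mx z).

Lemma pt3_eta w : exists x y z, w = pt3 x y z.
Proof.
exists (usubmx w 0 0), (usubmx w 1 0), (dsubmx w 0 0).
rewrite /pt3 -pt2_eta -[LHS]vsubmxK; congr col_mx.
by apply/colP => i; rewrite [RHS]mxE (ord1 i).
Qed.

Lemma pt3_inj x y z x' y' z' :
  pt3 x y z = pt3 x' y' z' -> [/\ x = x', y = y' & z = z'].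
Proof.
move/eq_col_mx => [/colP e /colP/(_ 0)]; rewrite !mxE => ->.
by have := e 0; have := e 1; rewrite !mxE.
Qed.

Lemma den_pt2 (x y : rat) : den (pt2 x y) = lcmn `|denq x| `|denq y|.
Proof. by rewrite /den !big_ord_recl big_ord0 !mxE /= lcmn1. Qed.

Lemma homog_pt2 (x y : rat) (x' y' : int) (d : nat) : den (pt2 x y) = d ->
  d%:R * x = x'%:~R -> d%:R * y = y'%:~R -> homog (pt2 x y) = pt3 x' y' d.
Proof.
move=> dE xE yE; apply: map_intr_inj; rewrite homogE dE /pt3 map_col_mx scale_col_mx.
congr col_mx; apply/colP => i; rewrite !mxE ?mulr1 //.
by case: eqP.
Qed.

Lemma I3P (i : 'I_3) : i = 0 \/ i = 1 \/ i = 2%:R.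
Proof.
by case: i => [[|[|[|]]]] //= ?; [left | right; left | right; right]; apply/val_inj.
Qed.

(** These vectors have determinant 1 up to sign; the coefficients of an
    arbitrary vector are given by Cramer's rule. *)
Lemma Zbasis_pt3 (p q b c : int) (B : 'I_(2 + 1) -> 'cV[int]_(2 + 1)) :
  c * p - q * b = 1 ->
  B 0 = pt3 0 p q -> B 1 = pt3 1 p q -> B 2%:R = pt3 0 b c -> Zbasis B.
Proof.
move=> det1 B0 B1 B2 w; have [x [y [z ->]]] := pt3_eta w.
have S (a : 'I_(2 + 1) -> int) : \sum_i a i *: B i =
    pt3 (a 1) ((a 0 + a 1) * p + a 2%:R * b) ((a 0 + a 1) * q + a 2%:R * c).
  rewrite sum_I3 B0 B1 B2 /pt3 !scale_col_mx !add_col_mx; congr col_mx.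
    by apply/colP => i; rewrite !mxE; case: eqP => _; ring.
  by apply/colP => i; rewrite !mxE; ring.
exists [ffun i : 'I_(2 + 1) =>
  nth 0 [:: c * y - b * z - x; x; p * z - q * y] i]; split.
  rewrite S !ffunE /=; congr pt3.
    by rewrite -[LHS]mul1r -det1; ring.
  by rewrite -[LHS]mul1r -det1; ring.
move=> a; rewrite S => /pt3_inj[-> -> ->]; apply/ffunP => i; rewrite ffunE.
have [-> | [-> | ->]] := I3P i; rewrite /=.
- by transitivity ((a 0 + a 1) * (c * p - q * b) - a 1); [|rewrite det1]; ring.
- by [].
- by rewrite -[RHS]mul1r -det1; ring.
Qed.

(** The triangle with vertices (0, p/q), (1/q, p/q) and (0, b/c), for
    r = p/q in lowest terms, is regular. *)
Lemma hline_vertex_den r (c : nat) (b : int) : (0 < c)%N ->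
  c%:Z * numq r - denq r * b = 1 -> vertex_den (hline r) c.
Proof.
move=> c0 cb.
have qR : (denq r)%:~R != 0 :> rat by rewrite intr_eq0 denq_neq0.
have cR : (c%:Z)%:~R != 0 :> rat by rewrite intr_eq0; lia.
set v2 : rat := b%:~R / c%:Z%:~R.
have dv2 : denq v2 = c.
  rewrite coprimeq_den ?gtz0_abs //=; first by case: eqP c0 => [[->] |].
  apply/(coprimezP b c); exists (- denq r, numq r) => /=.
  by rewrite -cb; ring.
have hv0 : homog (pt2 0 r) = pt3 0 (numq r) (denq r).
  rewrite -absz_denq; apply: homog_pt2; rewrite ?mulr0 //.
    by rewrite den_pt2 lcm1n.
  by rewrite pmulrn absz_denq numqE mulrC.
have hv1 : homog (pt2 (denq r)%:~R^-1 r) = pt3 1 (numq r) (denq r).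
  rewrite -absz_denq; apply: homog_pt2.
  - rewrite den_pt2 absz_denq denqVz ?denq_neq0 // normr_denq.
    by rewrite /lcmn gcdnn mulnK // absz_gt0 denq_neq0.
  - by rewrite absz_denq pmulrn absz_denq mulfV.
  - by rewrite pmulrn absz_denq numqE mulrC.
have hv2 : homog (pt2 0 v2) = pt3 0 b c.
  apply: homog_pt2; rewrite ?mulr0 //.
    by rewrite den_pt2 lcm1n dv2.
  by rewrite pmulrn mulrC divfK.
pose v (i : 'I_3) := nth 0 [:: pt2 0 r; pt2 (denq r)%:~R^-1 r; pt2 0 v2] i.
exists 1%N, v; split.
- exact: affine_dim_hline.
- split; last first.
    exists (fun i => homog (v i)), id; split=> //.
    exact: (Zbasis_pt3 cb).
  move=> a a0 av.
  have S (l : 'I_2) : a 0 * ratpt R (v 0) l 0 + a 1 * ratpt R (v 1) l 0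
      + a 2%:R * ratpt R (v 2%:R) l 0 = 0.
    by move/colP/(_ l): av; rewrite sum_I3 !mxE.
  have {}a0 : a 0 + a 1 + a 2%:R = 0 by rewrite -sum_I3.
  have := S 0; have := S 1; rewrite !mxE /= => S1 S0.
  have a1 : a 1 = 0.
    apply/eqP; move/eqP: S0; rewrite rmorph0 !mulr0 add0r addr0 mulf_eq0.
    by rewrite fmorph_eq0 invr_eq0 (negPf qR) orbF.
  have {}a0 : a 0 = - a 2%:R.
    by apply/eqP; move/eqP: a0; rewrite a1 addr0 addr_eq0.
  have a2 : a 2%:R = 0.
    apply/eqP; move/eqP: S1; rewrite a0 a1 mul0r addr0 mulNr -mulrN addrC.
    rewrite -mulrDr -rmorphB mulf_eq0 fmorph_eq0 => /orP[// | /eqP vr].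
    have := congr1 (fun z : int => z%:~R : rat) cb.
    rewrite rmorphB !rmorphM /= numqE (_ : r = v2); last first.
      by apply/eqP; rewrite -subr_eq0 -opprB vr oppr0.
    rewrite /v2 => /eqP.
    by rewrite (_ : _ - _ = 0) ?(eq_sym 0) ?oner_eq0 //; field.
  by move=> i; have [-> | [-> | ->]] := I3P i => //; rewrite a0 a2 oppr0.
- by case=> [[|[|]]] //= ? _; rewrite /hline /= !mxE.
- by exists 2%:R; rewrite /= den_pt2 dv2 lcm1n.
Qed.

(** For q the denominator of r, the witness m lies in [1, q] and represents
    the inverse of p modulo q. So if the minimum is a multiple of q, it must be
    equal to q and to m, and the congruence holds in that case too. *)
Lemma c_pt_hline a r : irrational a -> exists k : int,
  pm1 ((c_pt (pt2 a (ratr r)))%:Z * numq r - denq r * k).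
Proof.
move=> irr; have [u [v uv]] := bezout_num_den r.
(* The representative of u modulo q in [1, q], rather than in [0, q - 1]:
   a vertex denominator is positive, also when q = 1. *)
pose m := `|((u - 1) %% denq r)%Z|%N.+1.
have mE : m%:Z = ((u - 1) %% denq r)%Z + 1.
  by rewrite /m -addn1 PoszD gez0_abs // modz_ge0 // denq_neq0.
have mq : m%:Z <= denq r by rewrite mE lezD1 ltz_pmod ?denq_gt0.
have mb : m%:Z * numq r - denq r * (- v - numq r * ((u - 1) %/ denq r)%Z) = 1.
  have := divz_eq (u - 1) (denq r); rewrite mE.
  move: (_ %/ _)%Z (_ %% _)%Z => d e ude.
  have -> : e = u - 1 - d * denq r by rewrite ude; ring.
  by rewrite -[RHS]uv; ring.
have := hline_vertex_den (ltn0Sn _) mb; rewrite -/m -(Fspace_hline r irr).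
case/c_pt_min; set c := c_pt _; rewrite (Fspace_hline r irr).
move=> /vertex_den_hline[c0 [qc | //]] cm.
exists (- v - numq r * ((u - 1) %/ denq r)%Z); left.
suff -> : c%:Z = m%:Z by [].
have /dvdzP[k ck] := qc; have := denq_gt0 r.
have : (m <= c)%N; last by lia.
by have := dvdn_leq c0 qc; lia.
Qed.

(** Modulo the common denominator, the numerators p and p' are both inverse
    to the same integer c_x up to sign. *)
Lemma c_pt_numq a a' r r' :
  irrational a -> irrational a' -> denq r = denq r' ->
  c_pt (pt2 a (ratr r)) = c_pt (pt2 a' (ratr r')) ->
  exists e m : int, pm1 e /\ numq r' = e * numq r + m * denq r.
Proof.
move=> irr irr' qq cc.
have [k kE] := c_pt_hline r irr; have [k' kE'] := c_pt_hline r' irr'.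
move: kE kE'; rewrite cc -qq; move: (_%:Z) (numq r) (numq r') (denq r) => c p p' q.
set e := c * p - _; set e' := c * p' - _ => eE eE'.
exists (e * e'), (e * (p * k' - p' * k)); split; first exact: pm1M.
have ee : e * e = 1 by case: eE => ->.
by rewrite -[LHS]mul1r -ee {2}/e /e'; ring.
Qed.

End Line.

(** * Points on rational lines with equal invariants *)

Section Converse.
Variable R : realType.
Implicit Types a : R.

(** The group contains 1/q by Bezout, and the irrationality of a' forces
    the coefficient of a' in an expression of 1/q to vanish. *)
Lemma Ggrp_line_denq_dvd a a' r r' : irrational a' ->
  Ggrp (pt2 a (ratr r)) = Ggrp (pt2 a' (ratr r')) -> (denq r %| denq r')%Z.
Proof.
move=> irr' G; have [u [v uv]] := bezout_num_den r.
have qR : (denq r)%:~R != 0 :> rat by rewrite intr_eq0 denq_neq0.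
have : Ggrp (pt2 a (ratr r)) (ratr (denq r)%:~R^-1).
  apply/Ggrp_pt2; exists v, 0, u; rewrite mul0r addr0 -!(ratr_int R) -rmorphM -rmorphD /=.
  congr ratr; apply: (mulIf qR); rewrite mulVf // mulrDl -mulrA -numqE.
  by rewrite -!rmorphM -rmorphD addrC /= uv.
rewrite G => /Ggrp_pt2[k [h [l e]]].
(* The coefficient h of a' vanishes, as h a' is rational. *)
have h0 : h%:~R = 0 :> rat.
  apply: (irrational_mul_eq0 (r := (denq r)%:~R^-1 - k%:~R - l%:~R * r') irr').
  by rewrite !rmorphB rmorphM /= e !ratr_int; ring.
have {}h0 : h = 0 by apply/eqP; rewrite -(intr_eq0 rat) h0.
move: e; rewrite h0 mul0r addr0 -!(ratr_int R) -rmorphM -rmorphD /= => /fmorph_inj e.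
apply/dvdzP; exists (k * denq r' + l * numq r'); apply: (@intr_inj rat).
rewrite rmorphM rmorphD !rmorphM /= numqE mulrA -mulrDl.
by rewrite -e mulrC mulrA mulfV ?mul1r.
Qed.

Lemma Ggrp_line_denq a a' r r' : irrational a -> irrational a' ->
  Ggrp (pt2 a (ratr r)) = Ggrp (pt2 a' (ratr r')) -> denq r = denq r'.
Proof.
move=> irr irr' G; have d := Ggrp_line_denq_dvd irr' G.
have d' := Ggrp_line_denq_dvd irr (esym G).
rewrite -(absz_denq r) -(absz_denq r'); congr Posz; apply/eqP.
by rewrite eqn_dvd; apply/andP.
Qed.

(** Writing r' = e r + m with e = 1 or -1 and a' = h a + l r + k, the
    irrationality of a makes h a unit, so the matrix with rows (h, l) and (0, e)
    is unimodular. *)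
Lemma orb_line a a' r r' : irrational a -> irrational a' ->
  Ggrp (pt2 a (ratr r)) = Ggrp (pt2 a' (ratr r')) ->
  c_pt (pt2 a (ratr r)) = c_pt (pt2 a' (ratr r')) ->
  orb (pt2 a (ratr r)) (pt2 a' (ratr r')).
Proof.
move=> irr irr' G C; have qq := Ggrp_line_denq irr irr' G.
have [e [m [eE pE]]] := c_pt_numq irr irr' qq C.
have rE : r' = e%:~R * r + m%:~R.
  have qR : (denq r)%:~R != 0 :> rat by rewrite intr_eq0 denq_neq0.
  apply: (mulIf qR); rewrite mulrDl -mulrA -numqE {1}qq -numqE pE.
  by rewrite rmorphD !rmorphM.
have /Ggrp_pt2[k [h [l aE]]] : Ggrp (pt2 a (ratr r)) a'.
  by rewrite G; apply: Ggrp_fst.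
have /Ggrp_pt2[k' [h' [l' aE']]] : Ggrp (pt2 a' (ratr r')) a.
  by rewrite -G; apply: Ggrp_fst.
(* Substituting a' in the expression of a leaves (h' h - 1) a rational. *)
have hh : (h' * h - 1)%:~R = 0 :> rat.
  apply: (irrational_mul_eq0 (r := - (k'%:~R + h'%:~R * (k%:~R + l%:~R * r) + l'%:~R * r')) irr).
  rewrite ratr_int rmorphB rmorphM rmorphN /= !rmorphD !rmorphM.
  rewrite rmorphD rmorphM /= !ratr_int.
  apply/eqP; rewrite -subr_eq0 opprK; apply/eqP.
  by rewrite mulrBl mul1r {2}aE' aE; ring.
have {}hh : h * h' = 1.
  by apply/eqP; rewrite mulrC -subr_eq0 -(intr_eq0 rat) hh.
have := @orb_pt2 R h l 0 e k m a (ratr r).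
have he : pm1 (h * e - l * 0).
  by rewrite mulr0 subr0; apply: pm1M => //; apply: pm1_mulr_eq1 hh.
move/(_ he); congr (orb _ (pt2 _ _)); first by rewrite aE; ring.
by rewrite rE rmorphD rmorphM /= !ratr_int; ring.
Qed.

Lemma orb_rational (s r s' r' : rat) :
  Ggrp (pt2 (ratr s) (ratr r)) = Ggrp (pt2 (ratr s') (ratr r') : 'cV[R]_2) ->
  orb (pt2 (ratr s) (ratr r) : 'cV[R]_2) (pt2 (ratr s') (ratr r')).
Proof.
have [D [D0 o]] := orb_ratpt R s r; have [D' [D0' o']] := orb_ratpt R s' r'.
rewrite (Ggrp_orb o) (Ggrp_orb o') => G.
apply: (orb_trans o); apply: orb_sym; apply: orb_trans o' _.
suff -> : D = D' by exact: orb_refl.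
have key (d d' : int) : 0 < d -> 0 < d' ->
    Ggrp (pt2 d%:~R^-1 0 : 'cV[R]_2) `<=` Ggrp (pt2 d'%:~R^-1 0) -> (d %| d')%Z.
  move=> d0 d0' /(_ d%:~R^-1 (Ggrp_fst _ _))[k [h]].
  rewrite sum_I2 !mxE /= mulr0 addr0 => E.
  have dR : d%:~R != 0 :> R by rewrite intr_eq0 gt_eqF.
  have dR' : d'%:~R != 0 :> R by rewrite intr_eq0 gt_eqF.
  apply/dvdzP; exists (k * d' + h 0); apply: (@intr_inj R).
  rewrite -[LHS]mulr1 -[X in _ * X](mulVf dR) E.
  by rewrite [in RHS]rmorphM /= rmorphD /= rmorphM /=; field.
have dd : (`|D| == `|D'|)%N.
  by rewrite eqn_dvd; apply/andP; split; apply: key => //; rewrite G.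
by rewrite -(gtz0_abs D0) -(gtz0_abs D0') (eqP dd).
Qed.

End Converse.

Theorem corollary6p2 (R : realType) (x x' : 'cV[R]_2) :
  orb x = orb x' <-> Ggrp x = Ggrp x' /\ c_pt x = c_pt x'.
Proof.
rewrite orb_eq; split=> [o | [G C]]; first by rewrite (Ggrp_orb o) (c_pt_orb o).
have [xind | /orb_rational_line[a [r o]]] := pselect (int_independent x).
  exact: orb_int_independent.
have [xind' | /orb_rational_line[a' [r' o']]] := pselect (int_independent x').
  exact/orb_sym/orb_int_independent.
apply: (orb_trans o); apply: orb_sym; apply: (orb_trans o'); apply: orb_sym.
rewrite (Ggrp_orb o) (Ggrp_orb o') in G; rewrite (c_pt_orb o) (c_pt_orb o') in C.
have rat_sub (b b' : R) (s s' : rat) : (exists t : rat, b = ratr t) ->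
    Ggrp (pt2 b (ratr s)) = Ggrp (pt2 b' (ratr s')) -> exists t : rat, b' = ratr t.
  move=> [t ->] E; have := Ggrp_fst b' (ratr s').
  rewrite -E => /Ggrp_pt2[k [h [l ->]]].
  by exists (k%:~R + h%:~R * t + l%:~R * s); rewrite !rmorphD !rmorphM /= !ratr_int.
have [ra | na] := pselect (exists t : rat, a = ratr t).
  have [t' aE'] := rat_sub _ _ _ _ ra G; have [t aE] := ra.
  by move: G; rewrite aE aE'; apply: orb_rational.
apply: (orb_line _ _ G C) => [t aE | t aE]; first by apply: na; exists t.
by apply: na; apply: (rat_sub _ _ _ _ _ (esym G)); exists t.
Qed.
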